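(* Fix $n,p\ge1$ and $b=(b_1,\dots,b_n)\in[0,1]^n$ (non-random). Then $$\hat R_b=\frac1{np}\sum_{i=1}^n\sum_{j=1}^p\Big[b_i^2(Y_{ij}-\bar Y_j)^2+\Big(1-2\big(1-\tfrac1n\big)b_i\Big)\frac{V(Y_{ij})}{\tau_{ij}+\nu_2}\Big]$$ is an unbiased estimator of the risk $R_b=E(\ell_b)$, i.e. $E(\hat R_b)=R_b$, where $$\ell_b=\frac1{np}\sum_{i=1}^n\sum_{j=1}^p(\hat\theta_{ij}^{b,\bar Y}-\theta_{ij})^2,\qquad \hat\theta_{ij}^{b,\bar Y}=(1-b_i)Y_{ij}+b_i\bar Y_j,\qquad \bar Y_j=\frac1n\sum_{i=1}^nY_{ij}.$$
   Context: $\Theta\subseteq\mathbb R$; $\nu_0,\nu_1,\nu_2\in\mathbb R$ are known constants and $V(t)=\nu_0+\nu_1t+\nu_2t^2$ satisfies $V(t)>0$ for all $t\in\Theta$. $Y_1,\dots,Y_n$ are mutually independent random vectors, $Y_i=(Y_{i1},\dots,Y_{ip})\in\mathbb R^p$, with finite mean and covariance matrix, $E(Y_{ij})=\theta_{ij}\in\Theta$ and $\operatorname{Var}(Y_{ij})=V(\theta_{ij})/\tau_{ij}$, where $\tau_{ij}\in\mathbb N$ ($\tau_{ij}\ge1$) are known constants with $\tau_{ij}+\nu_2\ne0$. *)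

(* Defs.v *)
From HB Require Import structures.
From mathcomp Require Import all_boot all_order all_algebra.
From mathcomp Require Import all_classical all_reals all_analysis.

Set Implicit Arguments.
Unset Strict Implicit.
Unset Printing Implicit Defensive.

Import Order.TTheory GRing.Theory Num.Theory.

Local Open Scope classical_set_scope.
Local Open Scope ring_scope.

(* Mutual independence of finitely many random elements X_i: the product rule
   for all measurable sets and all subfamilies J. *)
Definition mutually_independent {d d' : measure_display} {T : measurableType d}
    {T' : measurableType d'} {R : realType} (P : probability T R) {I : finType}
    (X : I -> {RV P >-> T'}) : Prop :=
  forall (J : {set I}) (A : I -> set T'), (forall i, measurable (A i)) ->
    P (\bigcap_(i in [set` J]) (X i @^-1` A i)) =
    (\prod_(i in J) P (X i @^-1` A i))%E.

Definition finite_mean {d : measure_display} {T : measurableType d}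
    {R : realType} (P : probability T R) {p : nat} (Z : T -> p.-tuple R) : Prop :=
  forall j : 'I_p, P.-integrable setT (fun w => (tnth (Z w) j)%:E).

Definition finite_covariance {d : measure_display} {T : measurableType d}
    {R : realType} (P : probability T R) {p : nat} (Z : T -> p.-tuple R) : Prop :=
  forall j k : 'I_p,
    covariance P (fun w => tnth (Z w) j) (fun w => tnth (Z w) k) \is a fin_num.

(* Integrability is part of unbiasedness: 'E_P[_] is total, with a conventional
   value when the expectation does not exist. *)
Definition unbiased {d : measure_display} {T : measurableType d} {R : realType}
    (P : probability T R) (est : T -> R) (r : \bar R) : Prop :=
  P.-integrable setT (EFin \o est) /\ 'E_P[est]%E = r.

Definition quad_var {R : realType} (nu0 nu1 nu2 t : R) : R :=
  nu0 + nu1 * t + nu2 * t ^+ 2.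

Section Shrinkage.
Context {R : realType} {n p : nat}.
(* One realization of the data: y i is the i-th observed vector. *)
Implicit Types (y : 'I_n -> p.-tuple R) (b : 'I_n -> R).

Definition grand_mean y (j : 'I_p) : R := n%:R^-1 * \sum_(i < n) tnth (y i) j.

Definition shrink b y (i : 'I_n) (j : 'I_p) : R :=
  (1 - b i) * tnth (y i) j + b i * grand_mean y j.

Definition loss (theta : 'I_n -> 'I_p -> R) b y : R :=
  (n * p)%:R^-1 *
  \sum_(i < n) \sum_(j < p) (shrink b y i j - theta i j) ^+ 2.

Definition risk_estimate (nu0 nu1 nu2 : R) (tau : 'I_n -> 'I_p -> nat) b y : R :=
  (n * p)%:R^-1 *
  \sum_(i < n) \sum_(j < p)
    (b i ^+ 2 * (tnth (y i) j - grand_mean y j) ^+ 2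
     + (1 - 2 * (1 - n%:R^-1) * b i)
       * (quad_var nu0 nu1 nu2 (tnth (y i) j) / ((tau i j)%:R + nu2))).

Definition risk {d : measure_display} {T : measurableType d}
    (P : probability T R) (theta : 'I_n -> 'I_p -> R) b
    (Y : 'I_n -> T -> p.-tuple R) : \bar R :=
  ('E_P[fun w => loss theta b (fun i => Y i w)])%E.

End Shrinkage.

(* Main.v *)
Require Import Defs.
From HB Require Import structures.
From mathcomp Require Import all_boot all_order all_algebra.
From mathcomp Require Import all_classical all_reals all_analysis.
From mathcomp Require Import measurable_realfun.
From mathcomp Require Import ring.

Set Implicit Arguments.
Unset Strict Implicit.
Unset Printing Implicit Defensive.

Import Order.TTheory GRing.Theory Num.Theory.

Local Open Scope classical_set_scope.
Local Open Scope ring_scope.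

(** The estimator is unbiased coordinate by coordinate.  Fix a pair (i, j), write
    Z_k = Y_kj - theta_kj for the centred data of column j, s_i for the variance
    of Z_i, and M for the column mean.  Since the column mean shrinks Y_ij to
    theta_ij + Z_i - b_i (Y_ij - M), the squared error splits as

      Z_i ^ 2 - 2 b_i Z_i (Y_ij - M) + b_i ^ 2 (Y_ij - M) ^ 2,

    whose last term already occurs in the estimator.  Independence makes the Z_k
    uncorrelated, so only the coefficient 1 - 1/n of Z_i in Y_ij - M contributes
    to the middle term: E[Z_i (Y_ij - M)] = (1 - 1/n) s_i.  The first two terms
    therefore contribute (1 - 2 (1 - 1/n) b_i) s_i.  On the other side, V is
    quadratic, hence E[V(Y_ij)] = V(theta_ij) + nu2 s_i = (tau_ij + nu2) s_i
    because s_i = V(theta_ij) / tau_ij; so V(Y_ij) / (tau_ij + nu2) is an unbiased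
    estimator of s_i, and both sides have the same mean
    ([has_mean_shrink_loss], [has_mean_shrink_estimate]).

    All random variables involved are quadratic polynomials in the Z_k, so their
    means and integrability follow by linearity from those of 1, Z_k and Z_i Z_k.
    The probabilistic input is that independent integrable variables have an
    integrable product whose mean is the product of the means
    ([has_mean_mul_indep]); this is Fubini's theorem for the joint law. *)

(** * Means of integrable random variables *)

(** 'E_P is a total operator and is linear only on integrable functions; carried
    together, integrability and the value of the mean are stable under linear
    combinations without side conditions. *)
Definition has_mean {d : measure_display} {T : measurableType d}
    {R : realType} (P : probability T R) (f : T -> R) (m : R) : Prop :=
  P.-integrable setT (EFin \o f) /\ ('E_P[f] = m%:E)%E.

Section HasMean.
Context {d : measure_display} {T : measurableType d} {R : realType}.
Context (P : probability T R).
Implicit Types (f g : T -> R) (m c : R).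

Lemma has_mean_integral f m : has_mean P f m -> (\int[P]_w (f w)%:E = m%:E)%E.
Proof. by case=> _; rewrite unlock. Qed.

Lemma has_mean_measurable f m : has_mean P f m -> measurable_fun setT f.
Proof. by case=> /measurable_int/measurable_EFinP. Qed.

Lemma has_mean_ext f g m : f =1 g -> has_mean P f m -> has_mean P g m.
Proof. by move=> /funext ->. Qed.

Lemma has_mean_cst c : has_mean P (fun=> c) c.
Proof.
split; last exact: expectation_cst.
exact: finite_measure_integrable_cst.
Qed.

Lemma has_meanD f g m m' : has_mean P f m -> has_mean P g m' ->
  has_mean P (fun w => f w + g w) (m + m').
Proof.
move=> [fi fE] [gi gE]; split; first exact: (integrableD _ fi gi).
by rewrite expectationD ?fE ?gE//; exact/Lfun1_integrable.
Qed.

Lemma has_meanZ c f m : has_mean P f m -> has_mean P (fun w => c * f w) (c * m).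
Proof.
move=> [fi fE]; split; first exact: (integrableZl _ c fi).
rewrite EFinM -fE -expectationZl; last exact/Lfun1_integrable.
by congr expectation; apply/funext => w /=; rewrite mulrC.
Qed.

Lemma has_mean_sum (I : finType) (F : I -> T -> R) (m : I -> R) :
  (forall i, has_mean P (F i) (m i)) ->
  has_mean P (fun w => \sum_i F i w) (\sum_i m i).
Proof.
move=> H; have -> : (fun w => \sum_i F i w) = \sum_i F i.
  by apply/funext => w; rewrite fct_sumE.
apply: (big_ind2 (has_mean P)) => //; first exact: has_mean_cst.
by move=> *; exact: has_meanD.
Qed.

(** The law of (f, g) agrees with the product of the two laws on rectangles,
    hence everywhere, which reduces the claim to the integral of x * y against a
    product measure.  The product is integrable there by Tonelli, so no
    square-integrability is asked of the factors. *)
Lemma has_mean_mul_indep f g m m' :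
  (forall A B, measurable A -> measurable B ->
    P (f @^-1` A `&` g @^-1` B) = (P (f @^-1` A) * P (g @^-1` B))%E) ->
  has_mean P f m -> has_mean P g m' ->
  has_mean P (fun w => f w * g w) (m * m').
Proof.
move=> ind hX hY.
pose X : {RV P >-> R} := mfun_Sub (mem_set (has_mean_measurable hX)).
pose Y : {RV P >-> R} := mfun_Sub (mem_set (has_mean_measurable hY)).
pose mX := distribution P X.
pose mY := distribution P Y.
pose h (z : R * R) : \bar R := (z.1 * z.2)%:E.
have mh : measurable_fun setT h.
  by apply/measurable_EFinP; apply: measurable_funM.
have intX : mX.-integrable setT EFin.
  by apply: integrable_pushforward => //; exact: hX.1.
have intY : mY.-integrable setT EFin.
  by apply: integrable_pushforward => //; exact: hY.1.
have EX : (\int[mX]_x x%:E = m%:E)%E.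
  by rewrite integral_distribution ?(has_mean_integral hX)//; exact: hX.1.
have EY : (\int[mY]_x x%:E = m'%:E)%E.
  by rewrite integral_distribution ?(has_mean_integral hY)//; exact: hY.1.
have prodh : (mX \x mY)%E.-integrable setT h.
  apply/integrable12ltyP => //.
  under eq_integral => x _.
    under eq_integral => y _ do rewrite /h /= normrM EFinM.
    rewrite integralZl//; last exact: (integrable_abse intY).
    over.
  have /= fY := integrable_fin_num measurableT (integrable_abse intY).
  rewrite -(fineK fY) integralZr//; last exact: (integrable_abse intX).
  have /= fX := integrable_fin_num measurableT (integrable_abse intX).
  by rewrite -(fineK fX) -EFinM ltry.
have Eh : (\int[(mX \x mY)%E]_z h z = (m * m')%:E)%E.
  rewrite -integral12_prod_meas1// /fubini_F.
  under eq_integral => x _.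
    under eq_integral => y _ do rewrite /h /= EFinM.
    rewrite integralZl// EY. over.
  by rewrite integralZr// EX.
pose XY w := (X w, Y w).
have mXY : measurable_fun setT XY by apply: measurable_fun_pair.
pose XYm : {mfun T >-> (R * R)%type} := mfun_Sub (mem_set mXY).
have law A : measurable A -> A `<=` setT -> pushforward P XYm A = (mX \x mY)%E A.
  move=> mA _; apply/esym.
  by apply: (product_measure_unique (m' := distribution P XYm)).
have intXY : P.-integrable setT (h \o XY).
  apply/integrableP; split; first exact: measurableT_comp.
  have /integrableP[_] := prodh.
  rewrite -(eq_measure_integral _ law) ge0_integral_pushforward//.
  exact: measurableT_comp.
split=> //.
by rewrite unlock -Eh -(eq_measure_integral _ law) integral_pushforward.
Qed.

(** A nonnegative function is its own absolute value, so a finite mean bounds its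
    L1 norm.  This is how square-integrability is extracted from a finite
    variance. *)
Lemma has_mean_ge0 f m : measurable_fun setT f -> (forall w, 0 <= f w) ->
  ('E_P[f] = m%:E)%E -> has_mean P f m.
Proof.
move=> mf f0 Ef; split => //; apply/integrableP; split.
  exact/measurable_EFinP.
under eq_integral => w _ do rewrite /= ger0_norm//.
by move: Ef; rewrite unlock => ->; rewrite ltry.
Qed.

Lemma has_mean_sqr_dev f mu v : has_mean P f mu -> ('V_P[f] = v%:E)%E ->
  has_mean P (fun w => (f w - mu) ^+ 2) v.
Proof.
move=> hf fv; apply: has_mean_ge0.
- apply: measurable_funX; apply: measurable_funB => //.
  exact: has_mean_measurable hf.
- by move=> w; exact: sqr_ge0.
- rewrite -fv /variance covariance.unlock hf.2 /=.
  by congr expectation; apply/funext => w; rewrite expr2.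
Qed.

End HasMean.

(** * Independence of functions of independent vectors *)

Lemma mutually_independent_comp {d d' d1 d2 : measure_display}
    {T : measurableType d} {T' : measurableType d'}
    {S1 : measurableType d1} {S2 : measurableType d2} {R : realType}
    (P : probability T R) {I : finType} (X : I -> {RV P >-> T'})
    (i k : I) (f : T' -> S1) (g : T' -> S2) :
  mutually_independent X -> i != k ->
  measurable_fun setT f -> measurable_fun setT g ->
  forall A B, measurable A -> measurable B ->
    P ((f \o X i) @^-1` A `&` (g \o X k) @^-1` B) =
    (P ((f \o X i) @^-1` A) * P ((g \o X k) @^-1` B))%E.
Proof.
move=> ind ik mf mg A B mA mB.
(* Only C i and C k matter: the product rule is used on the subfamily {i, k}. *)
pose C l := if l == i then f @^-1` A else g @^-1` B.
have Ck : C k = g @^-1` B by rewrite /C eq_sym (negbTE ik).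
have mC l : measurable (C l).
  rewrite /C; case: ifP => _; rewrite -[X in measurable X]setTI.
    exact: mf.
  exact: mg.
have := ind [set i; k]%SET C mC.
rewrite big_setU1 ?inE//= big_set1 Ck {2}/C eqxx => <-.
congr (P _); apply/seteqP; split=> w /=.
  by move=> [Aw Bw] l; rewrite /= !inE => /orP[] /eqP ->; rewrite ?Ck// /C eqxx.
move=> H; split.
  by have := H i; rewrite /= !inE eqxx /C eqxx; apply.
by have := H k; rewrite /= !inE eqxx orbT Ck; apply.
Qed.

(** * Affine functions of uncorrelated centred variables *)

Section Uncorrelated.
Context {d : measure_display} {T : measurableType d} {R : realType}.
Context (P : probability T R) {I : finType} (Z : I -> T -> R) (s : I -> R).
Hypothesis Z_mean : forall i, has_mean P (Z i) 0.
Hypothesis Z_cov : forall i k,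
  has_mean P (fun w => Z i w * Z k w) (if k == i then s i else 0).

(** Of all the covariances of Z i with the affine combination, only the diagonal
    one survives. *)
Lemma has_mean_mul_affine (i : I) (c : R) (a : I -> R) :
  has_mean P (fun w => Z i w * (c + \sum_k a k * Z k w)) (a i * s i).
Proof.
have -> : a i * s i = c * 0 + \sum_k a k * (if k == i then s i else 0).
  rewrite mulr0 add0r (bigD1 i)//= eqxx big1 ?addr0// => k /negbTE ->.
  by rewrite mulr0.
apply: (@has_mean_ext _ _ _ _
    (fun w => c * Z i w + \sum_k a k * (Z i w * Z k w))).
  move=> w; rewrite mulrDr [c * _]mulrC mulr_sumr; congr (_ + _).
  by apply: eq_bigr => k _; rewrite mulrCA.
apply: has_meanD; first exact: has_meanZ.
by apply: has_mean_sum => k; exact: has_meanZ.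
Qed.

Lemma has_mean_affine (c : R) (a : I -> R) :
  has_mean P (fun w => c + \sum_k a k * Z k w) c.
Proof.
rewrite -[X in has_mean _ _ X]addr0; apply: has_meanD; first exact: has_mean_cst.
rewrite -[X in has_mean _ _ X](@big1 R 0 +%R I (index_enum I) xpredT
  (fun k => a k * 0)).
  by apply: has_mean_sum => k; exact: has_meanZ.
by move=> k _; rewrite mulr0.
Qed.

Lemma has_mean_sqr_affine (c : R) (a : I -> R) :
  has_mean P (fun w => (c + \sum_k a k * Z k w) ^+ 2)
    (c ^+ 2 + \sum_k a k * (a k * s k)).
Proof.
apply: (@has_mean_ext _ _ _ _ (fun w => c * (c + \sum_k a k * Z k w) +
    \sum_k a k * (Z k w * (c + \sum_l a l * Z l w)))).
  move=> w; rewrite expr2 mulrDl; congr (_ + _).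
  by rewrite mulr_suml; apply: eq_bigr => k _; rewrite mulrA.
apply: has_meanD; first by rewrite expr2; apply/has_meanZ/has_mean_affine.
by apply: has_mean_sum => k; apply/has_meanZ/has_mean_mul_affine.
Qed.

End Uncorrelated.

(** * Shrinkage of one column of the data towards its mean *)

Section Coordinate.
Context {d : measure_display} {T : measurableType d} {R : realType}.
Context (P : probability T R) {n : nat} (X : 'I_n -> T -> R).
Context (theta s : 'I_n -> R).
Let Z i w := X i w - theta i.
Hypothesis Z_mean : forall i, has_mean P (Z i) 0.
Hypothesis Z_cov : forall i k,
  has_mean P (fun w => Z i w * Z k w) (if k == i then s i else 0).
Let M w := n%:R^-1 * \sum_(k < n) X k w.

Let dev_affine i w : X i w - M w =
  (theta i - n%:R^-1 * \sum_k theta k)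
  + \sum_k ((k == i)%:R - n%:R^-1) * Z k w.
Proof.
rewrite /M /Z.
under [X in _ = _ + X]eq_bigr => k _ do rewrite mulrBl.
have Zi : \sum_k (k == i)%:R * (X k w - theta k) = X i w - theta i.
  rewrite (bigD1 i)//= eqxx mul1r big1 ?addr0// => k /negbTE ->.
  by rewrite mul0r.
by rewrite sumrB Zi -mulr_sumr sumrB; ring.
Qed.

(** The value of E[(X i - M) ^ 2]: squared bias plus variance of the affine
    combination in [dev_affine]. *)
Let sqr_dev_mean i : R := (theta i - n%:R^-1 * \sum_k theta k) ^+ 2 +
  \sum_k ((k == i)%:R - n%:R^-1) * (((k == i)%:R - n%:R^-1) * s k).

Let has_mean_sqr_dev_M i :
  has_mean P (fun w => (X i w - M w) ^+ 2) (sqr_dev_mean i).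
Proof.
apply: has_mean_ext (has_mean_sqr_affine Z_mean Z_cov _ _) => w /=.
by rewrite dev_affine.
Qed.

Let has_mean_Z_dev i :
  has_mean P (fun w => Z i w * (X i w - M w)) ((1 - n%:R^-1) * s i).
Proof.
have := has_mean_mul_affine Z_mean Z_cov i (theta i - n%:R^-1 * \sum_k theta k)
  (fun k => (k == i)%:R - n%:R^-1).
rewrite /= eqxx; apply: has_mean_ext => w /=.
by rewrite dev_affine.
Qed.

Definition shrink_risk (b : R) (i : 'I_n) : R :=
  b ^+ 2 * sqr_dev_mean i + (1 - 2 * (1 - n%:R^-1) * b) * s i.

Let Z_sqr i : has_mean P (fun w => Z i w * Z i w) (s i).
Proof. by have := Z_cov i i; rewrite eqxx. Qed.

Lemma has_mean_shrink_loss (b : R) (i : 'I_n) :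
  has_mean P (fun w => ((1 - b) * X i w + b * M w - theta i) ^+ 2)
    (shrink_risk b i).
Proof.
have -> : shrink_risk b i =
    b ^+ 2 * sqr_dev_mean i + (s i + - (2 * b) * ((1 - n%:R^-1) * s i)).
  by rewrite /shrink_risk; ring.
apply: has_mean_ext (has_meanD (has_meanZ _ (has_mean_sqr_dev_M i))
  (has_meanD (Z_sqr i) (has_meanZ _ (has_mean_Z_dev i)))) => w.
by rewrite /Z; ring.
Qed.

(** Expanding the quadratic V at theta i turns the variance law
    s i = V (theta i) / t into E[V (X i)] = (t + nu2) * s i. *)
Lemma has_mean_quad_var (nu0 nu1 nu2 t : R) (i : 'I_n) :
  t != 0 -> t + nu2 != 0 -> s i = quad_var nu0 nu1 nu2 (theta i) / t ->
  has_mean P (fun w => quad_var nu0 nu1 nu2 (X i w) / (t + nu2)) (s i).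
Proof.
move=> t0 tnu si.
pose v := quad_var nu0 nu1 nu2 (theta i).
have -> : s i = (t + nu2)^-1 *
    (v + ((nu1 + 2 * nu2 * theta i) * 0 + nu2 * s i)).
  by rewrite si -/v; field; rewrite t0.
apply: has_mean_ext (has_meanZ _ (has_meanD (has_mean_cst P v)
  (has_meanD (has_meanZ _ (Z_mean i)) (has_meanZ _ (Z_sqr i))))) => w.
by rewrite /v /Z /quad_var; ring.
Qed.

Lemma has_mean_shrink_estimate (nu0 nu1 nu2 t b : R) (i : 'I_n) :
  t != 0 -> t + nu2 != 0 -> s i = quad_var nu0 nu1 nu2 (theta i) / t ->
  has_mean P (fun w => b ^+ 2 * (X i w - M w) ^+ 2 +
      (1 - 2 * (1 - n%:R^-1) * b) *
      (quad_var nu0 nu1 nu2 (X i w) / (t + nu2)))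
    (shrink_risk b i).
Proof.
move=> t0 tnu si; apply: has_meanD; apply: has_meanZ.
  exact: has_mean_sqr_dev_M.
exact: has_mean_quad_var.
Qed.

End Coordinate.

Theorem proposition4p1 (R : realType) (d : measure_display)
    (Omega : measurableType d) (P : probability Omega R)
    (n p : nat) (hn : (1 <= n)%N) (hp : (1 <= p)%N)
    (Theta : set R) (nu0 nu1 nu2 : R)
    (hV : forall t, Theta t -> 0 < quad_var nu0 nu1 nu2 t)
    (tau : 'I_n -> 'I_p -> nat)
    (htau : forall i j, (1 <= tau i j)%N)
    (htau_nu2 : forall i j, (tau i j)%:R + nu2 != 0)
    (theta : 'I_n -> 'I_p -> R)
    (htheta : forall i j, Theta (theta i j))
    (Y : 'I_n -> {RV P >-> p.-tuple R})
    (hindep : mutually_independent Y)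
    (hmean : forall i, finite_mean P (Y i))
    (hcov : forall i, finite_covariance P (Y i))
    (hE : forall i j, ('E_P[fun w => tnth (Y i w) j] = (theta i j)%:E)%E)
    (hVar : forall i j, ('V_P[fun w => tnth (Y i w) j] =
       (quad_var nu0 nu1 nu2 (theta i j) / (tau i j)%:R)%:E)%E)
    (b : 'I_n -> R) (hb : forall i, 0 <= b i <= 1) :
  unbiased P
    (fun w => risk_estimate nu0 nu1 nu2 tau b (fun i => Y i w))
    (risk P theta b Y).
Proof.
have Y_mean i j : has_mean P (fun w => tnth (Y i w) j) (theta i j).
  by split; [exact: hmean|exact: hE].
have Z_mean j i : has_mean P (fun w => tnth (Y i w) j - theta i j) 0.
  by rewrite -(subrr (theta i j)); apply: has_meanD => //; exact: has_mean_cst.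
have Z_cov j i k : has_mean P
    (fun w => (tnth (Y i w) j - theta i j) * (tnth (Y k w) j - theta k j))
    (if k == i then quad_var nu0 nu1 nu2 (theta i j) / (tau i j)%:R else 0).
  have [->|ki] := eqVneq k i.
    by apply: has_mean_ext (has_mean_sqr_dev (Y_mean i j) (hVar i j)).
  rewrite -(mulr0 0); apply: has_mean_mul_indep => //.
  have mdev l : measurable_fun setT (fun y : p.-tuple R => tnth y j - theta l j).
    by apply: measurable_funB => //; exact: measurable_tnth.
  apply: (mutually_independent_comp hindep _ (mdev i) (mdev k)).
  by rewrite eq_sym.
pose s j i := quad_var nu0 nu1 nu2 (theta i j) / (tau i j)%:R.
pose m := (n * p)%:R^-1 *
  \sum_(i < n) \sum_(j < p) shrink_risk (theta^~ j) (s j) (b i) i.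
have loss_mean : has_mean P (fun w => loss theta b (fun i => Y i w)) m.
  apply/has_meanZ/has_mean_sum => i; apply: has_mean_sum => j.
  exact: (has_mean_shrink_loss (Z_mean j) (Z_cov j)).
have [est_int est_mean] : has_mean P
    (fun w => risk_estimate nu0 nu1 nu2 tau b (fun i => Y i w)) m.
  apply/has_meanZ/has_mean_sum => i; apply: has_mean_sum => j.
  apply: (has_mean_shrink_estimate (Z_mean j) (Z_cov j)) => //.
  by rewrite pnatr_eq0 -lt0n.
by split=> //; rewrite est_mean /risk loss_mean.2.
Qed.
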